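(* Let $K$ be a division ring, $G$ a group of automorphisms of $K$, and $\Delta\subseteq K$ a $G$-algebraic set. Then the $G$-polynomial $f=f_{\Delta,G}$ factorizes linearly in $K[t]$: $f=(t-b_1)\cdots(t-b_n)$ with $b_1,\dots,b_n\in K$. Moreover, any root of $f$ in $K$ is conjugate to some $b_i$, and each $b_i$ is conjugate to an element of $\bigcup_{\sigma\in G}\sigma(\Delta)$.
   Context: $K[t]$ is the usual polynomial ring with central indeterminate $t$; for $f=\sum a_it^i\in K[t]$ and $a\in K$, $f(a)=\sum a_ia^i$ (the remainder of right division of $f$ by $t-a$), and $a$ is a root of $f$ if $f(a)=0$. $K^G:=\{x\in K:\sigma(x)=x\ \forall\sigma\in G\}$. A subset $\Delta\subseteq K$ is $G$-algebraic if there is a monic polynomial $f\in K^G[t]$ with $f(x)=0$ for all $x\in\Delta$; the monic polynomial of minimal degree in $K^G[t]$ vanishing on $\Delta$ is denoted $f_{\Delta,G}$, and polynomials of this form are called $G$-polynomials. Elements $a,b\in K$ are conjugate if $b=xax^{-1}$ for some $x\in K\setminus\{0\}$. *)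

(* Defs.v *)
From mathcomp Require Import all_boot all_order all_algebra.
From mathcomp Require Import boolp classical_sets.

Set Implicit Arguments.
Unset Strict Implicit.
Unset Printing Implicit Defensive.

Import GRing.Theory.

Local Open Scope classical_set_scope.
Local Open Scope ring_scope.

(* A division ring is a unitRingType K (nontrivial by definition, not
   necessarily commutative) satisfying GRing.field_axiom K, i.e. every nonzero
   element is a unit.  For p : {poly K}, 'X is central and p.[a] is
   \sum_i p`_i * a ^+ i, with the coefficients on the left. *)

Section GPolynomials.
Variable K : unitRingType.
Implicit Types (G : set {rmorphism K -> K}) (D : set K) (f g : {poly K}).

Record automorphism_group G : Prop := AutomorphismGroup {
  aut_id : G idfun;
  aut_comp : forall s t : {rmorphism K -> K}, G s -> G t -> G (s \o t);
  aut_inv : forall s : {rmorphism K -> K}, G s ->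
    exists2 t : {rmorphism K -> K}, G t & cancel s t /\ cancel t s
}.

Definition fixed_ring G : set K :=
  [set x | forall s : {rmorphism K -> K}, G s -> s x = x].

Definition vanishing_monic G D : set {poly K} :=
  [set f | [/\ f \is monic, forall i, fixed_ring G f`_i
             & forall x, D x -> root f x]].

Definition G_algebraic G D : Prop := vanishing_monic G D !=set0.

Definition minimal_vanishing_monic G D : set {poly K} :=
  [set f | vanishing_monic G D f /\
     forall g, vanishing_monic G D g -> (size f <= size g)%N].

(* The polynomial f_{D,G}; the value 0 is only taken when D is not
   G-algebraic, see Gpoly_minimal and Gpoly_unique. *)
Definition Gpoly G D : {poly K} := xget 0 (minimal_vanishing_monic G D).

Definition conjugate (a b : K) : Prop :=
  exists2 x : K, x != 0 & b = x * a * x^-1.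

Lemma Gpoly_minimal G D :
  G_algebraic G D -> minimal_vanishing_monic G D (Gpoly G D).
Proof.
move=> [f0 vf0]; apply: xgetPex.
pose P n := `[< exists2 f, vanishing_monic G D f & size f = n >].
have exP : exists n, P n by exists (size f0); apply/asboolP; exists f0.
case: (ex_minnP exP) => n /asboolP[f vf <-] minf.
by exists f; split=> // g vg; apply: minf; apply/asboolP; exists g.
Qed.

Lemma Gpoly_unique G D f : GRing.field_axiom K ->
  minimal_vanishing_monic G D f -> f = Gpoly G D.
Proof.
move=> divK [vf minf].
have [vg ming] : minimal_vanishing_monic G D (Gpoly G D).
  by apply: Gpoly_minimal; exists f.
move: (Gpoly G D) vg ming => g vg ming.
have eq_size : size f = size g by apply/eqP; rewrite eqn_leq minf ?ming.
have [[mf Gf Df] [mg Gg Dg]] := (vf, vg).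
apply/eqP; rewrite -subr_eq0; apply/negPn/negP => h_neq0.
set h := f - g in h_neq0.
have Gh i : fixed_ring G h`_i.
  by move=> s Gs; rewrite coefB rmorphB Gf ?Gg.
have lh_unit : lead_coef h \is a GRing.unit by rewrite divK ?lead_coef_eq0.
have lh_reg : GRing.lreg (lead_coef h)^-1 by apply: mulrI; rewrite unitrV.
have vh : vanishing_monic G D ((lead_coef h)^-1 *: h).
  split.
  - by apply/monicP; rewrite lead_coefE lreg_size // coefZ -lead_coefE mulVr.
  - by move=> i s Gs; rewrite coefZ rmorphM rmorphV //= !Gh.
  - move=> x Dx; apply/rootP; rewrite hornerZ hornerD hornerN.
    by rewrite (rootP (Df x Dx)) (rootP (Dg x Dx)) subrr mulr0.
have := minf _ vh; rewrite lreg_size //.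
have f_neq0 : (0 < size f)%N by rewrite size_poly_gt0 monic_neq0.
rewrite leqNgt => /negP; apply.
have hle : (size h <= size f)%N.
  by rewrite (leq_trans (size_polyD _ _)) // size_polyN eq_size maxnn.
rewrite ltn_neqAle hle andbT; apply/eqP => eq_h.
move/eqP: h_neq0; apply; apply/eqP; rewrite -lead_coef_eq0 lead_coefE eq_h.
by rewrite coefB -lead_coefE eq_size -lead_coefE (monicP mf) (monicP mg) subrr.
Qed.

End GPolynomials.

(* Main.v *)
Require Import Defs.
From mathcomp Require Import all_boot all_order all_algebra.
From mathcomp Require Import boolp classical_sets.

(** Let [E] be the union of the translates [s @` D], [s] in [G].  Polynomials
    over [K] that vanish on [E] form a left ideal, and the crux is that
    [Gpoly G D] is its monic generator, although it is defined by minimality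
    among polynomials over the fixed ring only.  On the one hand a polynomial
    over the fixed ring that vanishes on [D] vanishes on [E].  On the other
    hand [G] permutes [E], hence acts on the left ideal, hence fixes its unique
    monic generator, whose coefficients are therefore [G]-invariant.

    The generator is a product of linear factors by a greedy construction
    ([generator_of_vanishing_polys]).  If a product [p] right-divides every
    polynomial vanishing on [E] but [p.[x] != 0] for some [x] in [E], then the
    product formula [(q * p).[x] = q.[x'] * p.[x]], with [x'] the conjugate of
    [x] by [p.[x]] ([horner_mul_conj]), shows that every cofactor has the root
    [x'], so that [('X - x'%:P) * p] has the same property.  The degree of any
    monic polynomial vanishing on [E] bounds the number of steps.  The same
    formula locates the roots of a product of linear factors
    ([root_prod_conjugate]). *)

Set Implicit Arguments.
Unset Strict Implicit.
Unset Printing Implicit Defensive.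

Import GRing.Theory.

Local Open Scope classical_set_scope.
Local Open Scope ring_scope.

Section DivisionRing.
Variable K : unitRingType.
Hypothesis divK : GRing.field_axiom K.

(** Evaluation is not multiplicative, as ['X] is central whereas [x] need not
    commute with the coefficients of [p]; conjugating by [p.[x]] makes up for
    moving [x] across that value. *)
Lemma horner_mul_conj (q p : {poly K}) (x : K) : p.[x] \is a GRing.unit ->
  (q * p).[x] = q.[p.[x] * x * p.[x]^-1] * p.[x].
Proof.
move=> u; elim/poly_ind: q => [|q c IH]; first by rewrite mul0r !horner0 mul0r.
rewrite mulrDl -mulrA -commr_polyX mulrA hornerD hornerMX IH.
by rewrite hornerMXaddC mul_polyC hornerZ mulrDl -!mulrA mulVr ?mulr1.
Qed.

Lemma root_mul_conj (q p : {poly K}) (x : K) : p.[x] != 0 ->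
  root (q * p) x = root q (p.[x] * x * p.[x]^-1).
Proof.
move=> px; have u := divK px.
by rewrite /root horner_mul_conj // mulIr_eq0 //; exact: mulIr.
Qed.

Lemma root_prod_conjugate (bs : seq K) (a : K) :
  root (\prod_(b <- bs) ('X - b%:P)) a -> exists2 b, b \in bs & conjugate a b.
Proof.
elim: bs => [|b bs IH]; first by rewrite big_nil (negPf (root1 _)).
rewrite big_cons; set p := \prod_(_ <- _) _.
have [/eqP pa _|pa] := eqVneq p.[a] 0.
  by have [c cbs ac] := IH pa; exists c; rewrite // inE cbs orbT.
rewrite root_mul_conj // root_XsubC => /eqP eb.
by exists b; [rewrite inE eqxx | exists p.[a]].
Qed.

Lemma monic_mul_eq (q p g : {poly K}) : p \is monic -> g \is monic ->
  g = q * p -> (size g <= size p)%N -> g = p.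
Proof.
move=> mp mg gE szg.
have mq : q \is monic by rewrite -(monicMr q mp) -gE.
suff /size1_polyC qC : (size q <= 1)%N.
  move: (monicP mq); rewrite qC lead_coefC => q1.
  by rewrite gE qC q1 mul1r.
have p_gt0 : (0 < size p)%N by rewrite size_poly_gt0 monic_neq0.
move: szg; rewrite gE size_Mmonic ?monic_neq0 //.
by case: (size p) p_gt0 => // n _; rewrite addnS /= -addn1 addnC leq_add2l.
Qed.

(** The invariant of the greedy construction: the product only lacks roots in
    [E] to generate the left ideal of polynomials vanishing on [E]. *)
Let partial_generator (E : set K) (bs : seq K) : Prop :=
  (forall g : {poly K}, (forall x, E x -> root g x) ->
     exists q, g = q * \prod_(b <- bs) ('X - b%:P)) /\
  (forall b, b \in bs -> exists2 c, E c & conjugate b c).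

Let partial_generator_cons (E : set K) (bs : seq K) (x : K) :
  let p := \prod_(b <- bs) ('X - b%:P) in
  partial_generator E bs -> E x -> p.[x] != 0 ->
  partial_generator E (p.[x] * x * p.[x]^-1 :: bs).
Proof.
move=> p [gen conjE] Ex px; have u := divK px; split=> [g vg|b].
  have [q gE] := gen g vg.
  have := vg x Ex; rewrite gE root_mul_conj // => /factor_theorem[r ->].
  by exists r; rewrite big_cons mulrA.
rewrite inE => /predU1P[->|]; last exact: conjE.
exists x => //; exists p.[x]^-1; first by rewrite invr_eq0.
by rewrite invrK -!mulrA mulVr // mulr1 mulrA mulVr // mul1r.
Qed.

Lemma generator_of_vanishing_polys (E : set K) (f : {poly K}) :
  f \is monic -> (forall x, E x -> root f x) ->
  exists bs : seq K,
    [/\ forall x, E x -> root (\prod_(b <- bs) ('X - b%:P)) x,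
        forall g : {poly K}, (forall x, E x -> root g x) ->
          exists q, g = q * \prod_(b <- bs) ('X - b%:P)
      & forall b, b \in bs -> exists2 c, E c & conjugate b c].
Proof.
move=> mf vf.
suff: forall n bs, (size f <= n + size bs)%N -> partial_generator E bs ->
    exists bs', partial_generator E bs' /\
      forall x, E x -> root (\prod_(b <- bs') ('X - b%:P)) x.
  move=> /(_ (size f) [::]) []; rewrite ?addn0 //.
    by split=> // g _; exists g; rewrite big_nil mulr1.
  by move=> bs [[gen conjE] van]; exists bs.
elim=> [|n IH] bs szf pg.
  (* the product has degree [size bs], too large to right-divide [f] *)
  have [q fE] := pg.1 f vf.
  have q_neq0 : q != 0.
    by apply: contraTneq (monic_neq0 mf) => q0; rewrite fE q0 mul0r eqxx.
  move: szf; rewrite add0n fE size_Mmonic ?monic_prod_XsubC //.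
  rewrite size_prod_XsubC addnS /= leqNgt -[X in (X < _)%N]add0n ltn_add2r.
  by rewrite size_poly_gt0 q_neq0.
have [van|] := pselect (forall x, E x -> root (\prod_(b <- bs) ('X - b%:P)) x).
  by exists bs.
move=> /existsNP[x /not_implyP[Ex /negP px]].
by apply: IH (partial_generator_cons pg Ex px); rewrite addnS.
Qed.

End DivisionRing.

Definition orbit_union (K : unitRingType) (G : set {rmorphism K -> K})
  (D : set K) : set K := \bigcup_(s in G) ((s : {rmorphism K -> K}) @` D).

Section Descent.
Variables (K : unitRingType) (G : set {rmorphism K -> K}) (D : set K).

Lemma map_poly_fixed (s : {rmorphism K -> K}) (f : {poly K}) :
  G s -> (forall i, fixed_ring G f`_i) -> map_poly s f = f.
Proof. by move=> Gs Gf; apply/polyP => i; rewrite coef_map /= Gf. Qed.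

Lemma vanishing_orbit_union (f : {poly K}) (x : K) :
  vanishing_monic G D f -> orbit_union G D x -> root f x.
Proof.
move=> [_ Gf vf] [s Gs [y Dy <-]].
by rewrite /root -(map_poly_fixed Gs Gf) horner_map (rootP (vf y Dy)) rmorph0.
Qed.

Lemma map_poly_orbit_union (s : {rmorphism K -> K}) (f : {poly K}) :
  automorphism_group G -> G s -> (forall x, orbit_union G D x -> root f x) ->
  forall x, orbit_union G D x -> root (map_poly s f) x.
Proof.
move=> autG Gs vf x [r Gr [y Dy <-]].
have [t Gt [_ tK]] := aut_inv autG Gs.
have vt : root f (t (r y)).
  by apply: vf; exists (t \o r); [exact: aut_comp | exists y].
by rewrite /root -[r y]tK horner_map (rootP vt) rmorph0.
Qed.

(** A monic generator of a [G]-stable left ideal is [G]-invariant, since each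
    translate is a monic element of the ideal of the same degree. *)
Lemma generator_vanishing_monic (p : {poly K}) :
  GRing.field_axiom K -> automorphism_group G -> p \is monic ->
  (forall x, orbit_union G D x -> root p x) ->
  (forall g : {poly K}, (forall x, orbit_union G D x -> root g x) ->
     exists q, g = q * p) ->
  vanishing_monic G D p.
Proof.
move=> divK autG mp vp gen; split=> // [i s Gs|x Dx]; last first.
  by apply: vp; exists idfun; [exact: aut_id | exists x].
have [q spE] := gen _ (map_poly_orbit_union autG Gs vp).
have msp := monic_map s mp.
have {2}<- : map_poly s p = p.
  exact: monic_mul_eq mp msp spE (size_poly _ _).
by rewrite coef_map.
Qed.

End Descent.

Theorem corollary7p4 (K : unitRingType) (divK : GRing.field_axiom K)
    (G : set {rmorphism K -> K}) (autG : automorphism_group G)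
    (D : set K) (algD : G_algebraic G D) :
  exists bs : seq K,
    [/\ Gpoly G D = \prod_(b <- bs) ('X - b%:P),
        forall a : K, root (Gpoly G D) a ->
          exists2 b : K, b \in bs & conjugate a b
      & forall b : K, b \in bs ->
          exists2 c : K,
            (\bigcup_(s in G) ((s : {rmorphism K -> K}) @` D)) c
            & conjugate b c].
Proof.
have [vf minf] := Gpoly_minimal algD.
have [mf _ _] := vf; have vfE x := @vanishing_orbit_union _ _ _ _ x vf.
have [bs [vp gen conjE]] := generator_of_vanishing_polys divK mf vfE.
have mp : \prod_(b <- bs) ('X - b%:P) \is monic by exact: monic_prod_XsubC.
have vmp := generator_vanishing_monic divK autG mp vp gen.
have [q fE] := gen _ vfE.
have fp := monic_mul_eq mp mf fE (minf _ vmp).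
by exists bs; split=> // a; rewrite fp; exact: root_prod_conjugate.
Qed.
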